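(* Let $R$ be an integral domain and let $S$ be an idempotent generated commutative $R$-algebra. Then $S$ is a Specker $R$-algebra if and only if $S$ is a torsion-free $R$-module.
   Context: All algebras are commutative and unital. A commutative $R$-algebra $S$ is idempotent generated if it is generated as an $R$-algebra by a set of idempotents. $\mathrm{Id}(S)$ is the set of idempotents of $S$, a Boolean algebra under $e\vee f=e+f-ef$, $e\wedge f=ef$, $\lnot e=1-e$. A nonzero idempotent $e\in S$ is faithful if for each $a\in R$, $ae=0$ implies $a=0$. A faithful generating algebra of idempotents of $S$ is a Boolean subalgebra $B$ of $\mathrm{Id}(S)$ that generates $S$ as an $R$-algebra and all of whose nonzero elements are faithful. $S$ is a Specker $R$-algebra if it is a commutative $R$-algebra that has a faithful generating algebra of idempotents. *)

(* Defs.v *)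
From HB Require Import structures.
From mathcomp Require Import all_boot all_order all_algebra.
From mathcomp Require Import classical_sets.

Set Implicit Arguments.
Unset Strict Implicit.
Unset Printing Implicit Defensive.

Import GRing.Theory.
Local Open Scope classical_set_scope.
Local Open Scope ring_scope.

(* MathComp's [comAlgType R] requires 1 != 0, whereas algebras may be zero here.
   A commutative unital R-algebra is therefore given by a possibly zero
   commutative ring with its structure map, r acting as multiplication by the
   image of r; any [comAlgType R] is an instance through [in_alg]. *)
Record comPzAlgType (R : pzRingType) := ComPzAlg {
  alg_ring : comPzRingType;
  alg_map : {rmorphism R -> alg_ring}
}.

Definition alg_sort (R : pzRingType) (S : comPzAlgType R) : Type := alg_ring S.
Coercion alg_sort : comPzAlgType >-> Sortclass.

Section AlgebraStructure.
Variables (R : pzRingType) (S : comPzAlgType R).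

HB.instance Definition _ := GRing.ComPzRing.on (alg_sort S).

Definition alg_scale (a : R) (s : S) : S := (alg_map S a : S) * s.

Fact alg_scaleA a b s : alg_scale a (alg_scale b s) = alg_scale (a * b) s.
Proof. by rewrite /alg_scale mulrA rmorphM. Qed.

Fact alg_scale1 : left_id 1 alg_scale.
Proof. by move=> s; rewrite /alg_scale rmorph1 mul1r. Qed.

Fact alg_scaleDr : right_distributive alg_scale +%R.
Proof. by move=> a s t; rewrite /alg_scale mulrDr. Qed.

Fact alg_scaleDl s : {morph alg_scale^~ s : a b / a + b}.
Proof. by move=> a b; rewrite /alg_scale rmorphD mulrDl. Qed.

HB.instance Definition _ := GRing.Zmodule_isLmodule.Build R (alg_sort S)
  alg_scaleA alg_scale1 alg_scaleDr alg_scaleDl.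

Lemma alg_scalerAl (a : R) (s t : S) : a *: (s * t) = (a *: s) * t.
Proof. exact: mulrA. Qed.

End AlgebraStructure.

Definition comPzAlg_of (R : comNzRingType) (A : comAlgType R) : comPzAlgType R :=
  ComPzAlg (in_alg A).

Lemma comPzAlg_of_scaleE (R : comNzRingType) (A : comAlgType R) (a : R) (s : A) :
  a *: (s : comPzAlg_of A) = a *: s :> A.
Proof. exact: mulr_algl. Qed.

Definition torsion_free (R : idomainType) (M : lmodType R) : Prop :=
  forall (a : R) (m : M), a *: m = 0 -> a = 0 \/ m = 0.

Section IdempotentGenerated.
Variables (R : comPzRingType) (S : comPzAlgType R).
Implicit Types (A B G : set S) (e f : S).

Definition is_subalgebra A : Prop :=
  GRing.submod_closed (mem A) /\ GRing.mulr_closed (mem A).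

Definition generates G : Prop := smallest is_subalgebra G = setT.

Definition idempotents : set S := [set e | e * e = e].

Definition idempotent_generated : Prop :=
  exists2 G, G `<=` idempotents & generates G.

Definition id_join e f : S := e + f - e * f.
Definition id_meet e f : S := e * f.
Definition id_compl e : S := 1 - e.

Definition is_boolean_subalgebra B : Prop :=
  [/\ B `<=` idempotents, B 0, B 1 &
   [/\ forall e f, B e -> B f -> B (id_join e f),
       forall e f, B e -> B f -> B (id_meet e f) &
       forall e, B e -> B (id_compl e)]].

Definition faithful e : Prop := forall a : R, a *: e = 0 -> a = 0.

Definition faithful_generating_algebra B : Prop :=
  [/\ is_boolean_subalgebra B, generates B &
      forall e, B e -> e <> 0 -> faithful e].

Definition specker : Prop := exists B, faithful_generating_algebra B.

End IdempotentGenerated.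

Arguments idempotents {R} S.
Arguments idempotent_generated {R} S.
Arguments specker {R} S.

(* Main.v *)
Require Import Defs.
From mathcomp Require Import all_boot all_order all_algebra.
From mathcomp Require Import boolp classical_sets.

(** For "torsion-free implies Specker", the algebra of all idempotents is
    faithful and generating.  For the converse, let B be a faithful generating
    algebra of idempotents.  Every s in S is piecewise scalar: the e in B with
    e s = c e for some scalar c have zero common annihilator, a property which
    passes to sums and products and holds for the elements of B.  If a s = 0
    with a <> 0, then for each such e either e = 0 or a c = 0, so e s = 0 in
    all cases, and s = 0. *)

Import GRing.Theory.
Local Open Scope classical_set_scope.
Local Open Scope ring_scope.

Section AlgebraTheory.
Variables (R : comPzRingType) (S : comPzAlgType R).
Implicit Types (A B G : set S) (a c d : R) (e f s t x : S).

Lemma alg_scalerAr a s t : a *: (s * t) = s * (a *: t).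
Proof. by rewrite mulrC alg_scalerAl mulrC. Qed.

Lemma generates_ind G A :
  generates G -> is_subalgebra A -> G `<=` A -> forall s, A s.
Proof.
move=> genG subA GA s.
by have : smallest (@is_subalgebra R S) G s; [rewrite genG | apply].
Qed.

Lemma generatesS G A : G `<=` A -> generates G -> generates A.
Proof.
move=> GA genG; apply/seteqP; split=> // s _ C [subC AC].
exact: generates_ind genG subC (subset_trans GA AC) s.
Qed.

Lemma idempotents_boolean : is_boolean_subalgebra (idempotents S).
Proof.
have meet e f : idempotents S e -> idempotents S f -> idempotents S (e * f).
  by rewrite /idempotents /= => ee ff; rewrite mulrACA ee ff.
have compl e : idempotents S e -> idempotents S (1 - e).
  by rewrite /idempotents /= => ee; rewrite mulrBr mulr1 mulrBl mul1r ee subrr subr0.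
split; [by []|exact: mulr0|exact: mulr1|split=> // e f ide idf].
(* By De Morgan, closure under joins reduces to closure under products and complements. *)
have -> : id_join e f = 1 - (1 - e) * (1 - f).
  rewrite /id_join mulrBr mulr1 mulrBl mul1r !opprB.
  by rewrite [RHS]addrC addrA subrK [RHS]addrC addrA.
exact: compl (meet _ _ (compl _ ide) (compl _ idf)).
Qed.

Definition scalar_on s : set S := [set e | exists c, e * s = c *: e].

(** Phrased through annihilators rather than a finite orthogonal decomposition of 1, which avoids
    all bookkeeping of decompositions. *)
Definition piecewise_scalar B s : Prop :=
  forall x, (forall e, B e -> scalar_on s e -> e * x = 0) -> x = 0.

Variable B : set S.
Hypothesis boolB : is_boolean_subalgebra B.

(** The products [f * e] play the role of a common refinement: if they all kill [x], then for fixed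
    [e] every [f] kills [e * x], so [e * x = 0]; letting [e] vary gives [x = 0]. *)
Lemma piecewise_scalar_comb s t u :
    (forall e f, scalar_on s e -> scalar_on t f -> scalar_on u (f * e)) ->
  piecewise_scalar B s -> piecewise_scalar B t -> piecewise_scalar B u.
Proof.
have [_ _ _ [_ meetB _]] := boolB.
move=> comb ps pt x ux0; apply: ps => e Be se; apply: pt => f Bf tf.
by rewrite mulrA; apply: ux0; [exact: meetB | exact: comb].
Qed.

Lemma piecewise_scalarZ1 a : piecewise_scalar B (a *: (1 : S)).
Proof.
have [_ _ B1 _] := boolB.
by move=> x /(_ 1 B1); rewrite mul1r; apply; exists a; rewrite mul1r.
Qed.

Lemma piecewise_scalar_subalgebra : is_subalgebra (piecewise_scalar B).
Proof.
have in_ps s : (s \in mem (piecewise_scalar B : set S)) = `[< piecewise_scalar B s >] by [].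
split; split.
- by rewrite in_ps -(scale0r (1 : S)); apply/asboolP/piecewise_scalarZ1.
- move=> a s t; rewrite !in_ps => /asboolP ps /asboolP pt; apply/asboolP.
  apply: piecewise_scalar_comb ps pt => e f [c ec] [d fd].
  (* On [f * e], [s] acts as [c] and [t] as [d]. *)
  exists (a * c + d).
  rewrite mulrDr -alg_scalerAr -mulrA ec mulrAC fd -alg_scalerAr -alg_scalerAl.
  by rewrite scalerA scalerDl.
- by rewrite in_ps -(scale1r (1 : S)); apply/asboolP/piecewise_scalarZ1.
- move=> s t; rewrite !in_ps => /asboolP ps /asboolP pt; apply/asboolP.
  apply: piecewise_scalar_comb ps pt => e f [c ec] [d fd].
  exists (d * c).
  by rewrite [s * t]mulrC mulrACA fd ec -alg_scalerAl -alg_scalerAr scalerA.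
Qed.

(** Multiplication by [e] is the scalar 1 on [e] and the scalar 0 on [1 - e], and these two sum to
    1. *)
Lemma piecewise_scalar_idempotent e : B e -> piecewise_scalar B e.
Proof.
have [idB _ _ [_ _ complB]] := boolB.
move=> Be x scal0; have ee : e * e = e := idB e Be.
have ex : e * x = 0 by apply: scal0 => //; exists 1; rewrite scale1r.
have : (1 - e) * x = 0.
  apply: scal0; first exact: complB.
  by exists 0; rewrite scale0r mulrBl mul1r ee subrr.
by rewrite mulrBl mul1r ex subr0.
Qed.

Lemma generated_piecewise_scalar s : generates B -> piecewise_scalar B s.
Proof.
move=> genB; exact: generates_ind genB piecewise_scalar_subalgebra
  piecewise_scalar_idempotent s.
Qed.

End AlgebraTheory.

Theorem proposition4p1 (R : idomainType) (S : comPzAlgType R) :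
  idempotent_generated S -> (specker S <-> torsion_free S).
Proof.
move=> [G idG genG]; split=> [[B [boolB genB faithB]] a s as0 | tfS].
- have [->|a0] := eqVneq a 0; [by left | right].
  (* The element tested against the annihilator condition of [s] is [s] itself. *)
  apply: (generated_piecewise_scalar _ _ _ boolB s genB) => e Be [c ec].
  have [->|/eqP e0] := eqVneq e 0; first exact: mul0r.
  (* Here [(a * c) *: e = a *: (e * s) = e * (a *: s) = 0], and [e] is faithful. *)
  have /eqP : a * c = 0.
    by apply: faithB Be e0 _ _; rewrite -scalerA -ec alg_scalerAr as0 mulr0.
  by rewrite mulf_eq0 (negPf a0) => /eqP c0; rewrite ec c0 scale0r.
- exists (idempotents S); split; first exact: idempotents_boolean.
    exact: generatesS idG genG.
  by move=> e _ e0 a /tfS[].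
Qed.
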